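(* Let $J_1,J_2,J_3,J_4$ be nonempty finite trees. Let $\Lambda$ be a $(J_2,J_1)$-bi-tree, $\Delta$ a $(J_3,J_2)$-bi-tree, $\Gamma$ a $(J_4,J_3)$-bi-tree. Then $$(\Lambda\diamond\Delta)\diamond\Gamma=\Lambda\diamond(\Delta\diamond\Gamma).$$
   Context: Let $I,J$ be nonempty finite trees. Let $\Gamma$ be a finite graph whose edges are colored black, blue, and red, equipped with embeddings $\imath:I\to\Gamma$, $\jmath:J\to\Gamma$. Denote by $\Gamma^{black}_{blue}$ the subgraph consisting of black and blue edges, by $\Gamma^{black}_{red}$ the subgraph consisting of black and red edges. $(\Gamma,\imath,\jmath)$ is an $(I,J)$-bi-tree if: the subgraphs $\Gamma^{black}_{blue}$ and $\Gamma^{black}_{red}$ are trees; $\imath(I)\subset\Gamma^{black}_{blue}$, $\jmath(J)\subset\Gamma^{black}_{red}$; any vertex of $\Gamma$ of valence 1 is an end of a black edge contained in $\imath(I)$ or $\jmath(J)$. Bi-trees are considered up to equivalence: $(\Gamma,\imath,\jmath)$ and $(\Gamma',\imath',\jmath')$ are equivalent if there is a color-preserving isomorphism $\lambda:\Gamma\to\Gamma'$ such that $\imath'=\lambda\circ\imath$, $\jmath'=\lambda\circ\jmath$. Product: for a $(K_2,K_1)$-bi-tree $\Delta$ and a $(K_3,K_2)$-bi-tree $\Gamma$, glue $\Gamma$ and $\Delta$ identifying the images of the embeddings $K_2\to\Gamma$, $K_2\to\Delta$. After this, edges of $K_2$ can carry double colors. Replace ($\Delta$-blue, $\Gamma$-black)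 $\to$ blue, ($\Delta$-black, $\Gamma$-red) $\to$ red, ($\Delta$-black, $\Gamma$-black) $\to$ black, and remove ($\Delta$-blue, $\Gamma$-red)-edges (other combinations of colors on edges of $K_2$ are impossible). Finally, remove all vertices of valence 1 that are not contained in the images of $K_1$ and $K_3$; repeat this step again, etc. The result, with the embeddings of $K_3$ (from $\Gamma$) and $K_1$ (from $\Delta$), is a $(K_3,K_1)$-bi-tree denoted $\Delta\diamond\Gamma$. *)

(* Defs.v *)
From HB Require Import structures.
From mathcomp Require Import all_boot.

Set Implicit Arguments.
Unset Strict Implicit.
Unset Printing Implicit Defensive.

(* Graphs are finite loopless multigraphs: gluing two bi-trees can create a
   blue and a red edge with the same two ends. *)
Record graph := Graph {
  vert : finType;
  edge : finType;
  ends : edge -> {set vert};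
  card_ends : forall e, #|ends e| = 2 }.

Arguments ends {g} e.

Definition valence (G : graph) (v : vert G) : nat :=
  #|[set e : edge G | v \in ends e]|.

Definition adjacent (G : graph) : rel (vert G) :=
  fun x y => [exists e, ends e == [set x; y]].

Definition connected (G : graph) : Prop :=
  forall x y : vert G, connect (@adjacent G) x y.

Fixpoint walk (G : graph) (x : vert G) (p : seq (edge G * vert G)) : bool :=
  if p is (e, y) :: q then (ends e == [set x; y]) && walk y q else true.

(* Two parallel edges form a cycle of length 2. *)
Definition is_cycle (G : graph) (x : vert G) (p : seq (edge G * vert G)) :=
  [&& p != [::], walk x p, last x (unzip2 p) == x,
      uniq (unzip1 p) & uniq (unzip2 p)].

Definition acyclic (G : graph) : Prop := forall x p, ~~ @is_cycle G x p.

(* The empty graph is not a tree. *)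
Definition is_tree (G : graph) : Prop :=
  [/\ 0 < #|vert G|, connected G & acyclic G].

Section Subgraph.
Variables (G : graph) (W : {set vert G}) (S : {set edge G}).

Definition sub_vert : finType := {v : vert G | v \in W}.
Definition sub_edge : finType := {e : edge G | (e \in S) && (ends e \subset W)}.
Definition sub_ends (e : sub_edge) : {set sub_vert} :=
  [set v | val v \in ends (val e)].

Lemma card_sub_ends e : #|sub_ends e| = 2.
Proof.
case/andP: (valP e) => _ /subsetP eW.
rewrite -(card_ends (val e)) -(card_imset _ val_inj); apply: eq_card => v.
apply/imsetP/idP => [[u + ->]|ve]; first by rewrite inE.
by exists (Sub v (eW v ve)); rewrite ?inE SubK.
Qed.

Definition subgraph : graph := Graph card_sub_ends.
End Subgraph.

(* All vertices are kept. *)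
Definition spanning_subgraph (G : graph) (S : {set edge G}) : graph :=
  subgraph [set: vert G] S.

Record embedding (G H : graph) := Embedding {
  emb_v : vert G -> vert H;
  emb_e : edge G -> edge H;
  emb_v_inj : injective emb_v;
  emb_e_inj : injective emb_e;
  emb_ends : forall e, ends (emb_e e) = emb_v @: ends e }.

Inductive color := Black | Blue | Red.

Definition color_code (c : color) : nat :=
  match c with Black => 0 | Blue => 1 | Red => 2 end.
Definition color_decode (n : nat) : color :=
  match n with 0 => Black | 1 => Blue | _ => Red end.
Lemma color_codeK : cancel color_code color_decode. Proof. by case. Qed.
HB.instance Definition _ := Equality.copy color (can_type color_codeK).

(* The data of an (I,J)-bi-tree, together with the two inclusions of images;
   these inclusions are exactly what the product needs in order to be
   defined. *)
Record bigraph (I J : graph) := Bigraph {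
  bg_graph :> graph;
  col : edge bg_graph -> color;
  imath : embedding I bg_graph;
  jmath : embedding J bg_graph;
  imath_col : forall e, col (emb_e imath e) != Red;
  jmath_col : forall e, col (emb_e jmath e) != Blue }.

Arguments col {I J b} e.
Arguments imath {I J} b.
Arguments jmath {I J} b.

(* Both subgraphs contain all the vertices: with edge-induced subgraphs
   instead, the product of two bi-trees would not always be a bi-tree. *)
Definition black_blue I J (G : bigraph I J) : graph :=
  spanning_subgraph [set e : edge G | col e != Red].
Definition black_red I J (G : bigraph I J) : graph :=
  spanning_subgraph [set e : edge G | col e != Blue].

Definition is_bitree I J (G : bigraph I J) : Prop :=
  [/\ is_tree (black_blue G),
      is_tree (black_red G) &
      forall v : vert G, valence v = 1 ->
        exists e : edge G, [/\ v \in ends e, col e = Black &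
          (e \in codom (emb_e (imath G))) || (e \in codom (emb_e (jmath G)))]].

Definition bi_equiv I J (G H : bigraph I J) : Prop :=
  exists (fv : vert G -> vert H) (fe : edge G -> edge H),
    [/\ bijective fv, bijective fe,
        forall e, ends (fe e) = fv @: ends e &
        forall e, col (fe e) = col e] /\
    [/\ forall x, fv (emb_v (imath G) x) = emb_v (imath H) x,
        forall e, fe (emb_e (imath G) e) = emb_e (imath H) e,
        forall x, fv (emb_v (jmath G) x) = emb_v (jmath H) x &
        forall e, fe (emb_e (jmath G) e) = emb_e (jmath H) e].

(* The pushout of two injections f : A -> B and g : A -> C, as the disjoint
   union of A and of the two complements of its images. *)
Section Gluing.
Variables (A B C : finType) (f : A -> B) (g : A -> C).

Definition off (D : finType) (h : A -> D) : finType :=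
  {d : D | d \notin codom h}.
Definition gluing : finType := (A + (off f + off g))%type.

Definition glue_l (b : B) : gluing :=
  match decP (@idP (b \in codom f)) with
  | left bf => inl (iinv bf)
  | right nbf => inr (inl (exist _ b (introN idP nbf)))
  end.
Definition glue_r (c : C) : gluing :=
  match decP (@idP (c \in codom g)) with
  | left cg => inl (iinv cg)
  | right ncg => inr (inr (exist _ c (introN idP ncg)))
  end.

Lemma glue_l_inj : injective glue_l.
Proof.
move=> x y; rewrite /glue_l.
case: (decP (@idP (x \in codom f))) => hx; case: (decP (@idP (y \in codom f))) => hy //.
  by case=> e; rewrite -(f_iinv hx) -(f_iinv hy) e.
by case.
Qed.

Lemma glue_r_inj : injective glue_r.
Proof.
move=> x y; rewrite /glue_r.
case: (decP (@idP (x \in codom g))) => hx; case: (decP (@idP (y \in codom g))) => hy //.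
  by case=> e; rewrite -(f_iinv hx) -(f_iinv hy) e.
by case.
Qed.

Lemma glue_l_im : injective f -> forall a, glue_l (f a) = inl a.
Proof.
move=> fI a; rewrite /glue_l; case: (decP (@idP (f a \in codom f))) => h.
  by congr inl; apply: fI; rewrite f_iinv.
by case: h; apply: codom_f.
Qed.

Lemma glue_r_im : injective g -> forall a, glue_r (g a) = inl a.
Proof.
move=> gI a; rewrite /glue_r; case: (decP (@idP (g a \in codom g))) => h.
  by congr inl; apply: gI; rewrite f_iinv.
by case: h; apply: codom_f.
Qed.
End Gluing.

Section Pruning.
Variables (G : graph) (S : {set edge G}) (F : {set vert G}).

Definition prune_step (W : {set vert G}) : {set vert G} :=
  [set v in W | (v \in F) ||
     (#|[set e in S | (v \in ends e) && (ends e \subset W)]| != 1)].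

(* The sequence of iterates is decreasing, hence stationary after #|vert G|
   steps. *)
Definition prune : {set vert G} := iter #|vert G| prune_step [set: vert G].

Lemma sub_prune : F \subset prune.
Proof.
rewrite /prune; elim: #|vert G| => [|n IH] /=; first exact: subsetT.
by apply/subsetP => v vF; rewrite inE (subsetP IH) // vF.
Qed.
End Pruning.

(* First argument: color in the (K2,K1)-bi-tree; second argument: color in the
   (K3,K2)-bi-tree. None stands for a removed edge; the combinations in the
   last line do not occur. *)
Definition mix (c d : color) : option color :=
  match c, d with
  | Blue, Black => Some Blue
  | Black, Red => Some Red
  | Black, Black => Some Black
  | Blue, Red => None
  | Red, _ | _, Blue => None
  end.

Section Diamond.
Variables (K1 K2 K3 : graph) (D : bigraph K2 K1) (G : bigraph K3 K2).

Local Notation fv := (emb_v (imath D)).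
Local Notation fe := (emb_e (imath D)).
Local Notation gv := (emb_v (jmath G)).
Local Notation ge := (emb_e (jmath G)).

Definition glued_vert : finType := gluing fv gv.
Definition glued_edge : finType := gluing fe ge.

Definition glued_ends (e : glued_edge) : {set glued_vert} :=
  match e with
  | inl k => (fun x => inl x : glued_vert) @: ends k
  | inr (inl d) => glue_l fv gv @: ends (val d)
  | inr (inr c) => glue_r fv gv @: ends (val c)
  end.

Lemma card_glued_ends e : #|glued_ends e| = 2.
Proof.
case: e => [k|[d|c]] /=; rewrite card_imset ?card_ends //.
- by move=> x y [].
- exact: glue_l_inj.
- exact: glue_r_inj.
Qed.

Definition glued : graph := Graph card_glued_ends.

Definition glued_col (e : edge glued) : option color :=
  match e with
  | inl k => mix (col (fe k)) (col (ge k))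
  | inr (inl d) => Some (col (val d))
  | inr (inr c) => Some (col (val c))
  end.

Definition glued_l : vert D -> vert glued := glue_l fv gv.
Definition glued_r : vert G -> vert glued := glue_r fv gv.
Definition glued_le : edge D -> edge glued := glue_l fe ge.
Definition glued_re : edge G -> edge glued := glue_r fe ge.

Lemma glued_le_ends e : ends (glued_le e) = glued_l @: ends e.
Proof.
rewrite /glued_le /glue_l; case: (decP (@idP (e \in codom fe))) => h //=.
rewrite -{2}(f_iinv h) emb_ends -imset_comp; apply: eq_imset => x /=.
by rewrite /glued_l glue_l_im //; apply: emb_v_inj.
Qed.

Lemma glued_re_ends e : ends (glued_re e) = glued_r @: ends e.
Proof.
rewrite /glued_re /glue_r; case: (decP (@idP (e \in codom ge))) => h //=.
rewrite -{2}(f_iinv h) emb_ends -imset_comp; apply: eq_imset => x /=.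
by rewrite /glued_r glue_r_im //; apply: emb_v_inj.
Qed.

Definition kept_edges : {set edge glued} := [set e | glued_col e != None].

Definition fixed_verts : {set vert glued} :=
  [set glued_r (emb_v (imath G) x) | x in [set: vert K3]] :|:
  [set glued_l (emb_v (jmath D) x) | x in [set: vert K1]].

Definition kept_verts : {set vert glued} := prune kept_edges fixed_verts.

Definition diamond_graph : graph := subgraph kept_verts kept_edges.

(* The default value is never used, by definition of [kept_edges]. *)
Definition diamond_col (e : edge diamond_graph) : color :=
  odflt Black (glued_col (val e)).

Lemma glued_col_r e : col e != Red ->
  (glued_col (glued_re e) != None) && (glued_col (glued_re e) != Some Red).
Proof.
rewrite /glued_re /glue_r; case: (decP (@idP (e \in codom ge))) => h /= nr.
  have := imath_col D (iinv h); have := jmath_col G (iinv h); move: nr.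
  rewrite f_iinv.
  by case: (col e) => //; case: (col (fe _)).
by apply: contraNN nr => /eqP[->].
Qed.

Lemma glued_col_l e : col e != Blue ->
  (glued_col (glued_le e) != None) && (glued_col (glued_le e) != Some Blue).
Proof.
rewrite /glued_le /glue_l; case: (decP (@idP (e \in codom fe))) => h /= nr.
  have := imath_col D (iinv h); have := jmath_col G (iinv h); move: nr.
  rewrite f_iinv.
  by case: (col e) => //; case: (col (ge _)).
by apply: contraNN nr => /eqP[->].
Qed.

Lemma diamond_iv_subproof x : glued_r (emb_v (imath G) x) \in kept_verts.
Proof.
apply: (subsetP (sub_prune _ _)); rewrite inE; apply/orP; left.
by apply/imsetP; exists x.
Qed.

Lemma diamond_jv_subproof x : glued_l (emb_v (jmath D) x) \in kept_verts.
Proof.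
apply: (subsetP (sub_prune _ _)); rewrite inE; apply/orP; right.
by apply/imsetP; exists x.
Qed.

Lemma diamond_ie_subproof e (e' := glued_re (emb_e (imath G) e)) :
  (e' \in kept_edges) && (ends e' \subset kept_verts).
Proof.
rewrite inE; have /andP[-> _] := glued_col_r (imath_col G e).
rewrite /e' glued_re_ends emb_ends -imset_comp.
by apply/subsetP => _ /imsetP[x _ ->]; apply: diamond_iv_subproof.
Qed.

Lemma diamond_je_subproof e (e' := glued_le (emb_e (jmath D) e)) :
  (e' \in kept_edges) && (ends e' \subset kept_verts).
Proof.
rewrite inE; have /andP[-> _] := glued_col_l (jmath_col D e).
rewrite /e' glued_le_ends emb_ends -imset_comp.
by apply/subsetP => _ /imsetP[x _ ->]; apply: diamond_jv_subproof.
Qed.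

Definition diamond_iv (x : vert K3) : vert diamond_graph :=
  exist (fun v => v \in kept_verts) _ (diamond_iv_subproof x).
Definition diamond_ie (e : edge K3) : edge diamond_graph :=
  exist (fun e => (e \in kept_edges) && (ends e \subset kept_verts))
    _ (diamond_ie_subproof e).
Definition diamond_jv (x : vert K1) : vert diamond_graph :=
  exist (fun v => v \in kept_verts) _ (diamond_jv_subproof x).
Definition diamond_je (e : edge K1) : edge diamond_graph :=
  exist (fun e => (e \in kept_edges) && (ends e \subset kept_verts))
    _ (diamond_je_subproof e).

Lemma diamond_iv_inj : injective diamond_iv.
Proof. by move=> x y /(congr1 val) /glue_r_inj /emb_v_inj. Qed.
Lemma diamond_ie_inj : injective diamond_ie.
Proof. by move=> x y /(congr1 val) /glue_r_inj /emb_e_inj. Qed.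
Lemma diamond_jv_inj : injective diamond_jv.
Proof. by move=> x y /(congr1 val) /glue_l_inj /emb_v_inj. Qed.
Lemma diamond_je_inj : injective diamond_je.
Proof. by move=> x y /(congr1 val) /glue_l_inj /emb_e_inj. Qed.

Lemma diamond_ie_ends e : ends (diamond_ie e) = diamond_iv @: ends e.
Proof.
apply/setP => v; rewrite inE.
rewrite [ends (val _)](glued_re_ends (emb_e (imath G) e)) emb_ends -imset_comp.
apply/imsetP/imsetP => -[x xe]; last by move=> ->; exists x.
by move=> vE; exists x => //; apply: val_inj.
Qed.

Lemma diamond_je_ends e : ends (diamond_je e) = diamond_jv @: ends e.
Proof.
apply/setP => v; rewrite inE.
rewrite [ends (val _)](glued_le_ends (emb_e (jmath D) e)) emb_ends -imset_comp.
apply/imsetP/imsetP => -[x xe]; last by move=> ->; exists x.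
by move=> vE; exists x => //; apply: val_inj.
Qed.

Lemma diamond_i_col e : diamond_col (diamond_ie e) != Red.
Proof.
have := glued_col_r (imath_col G e).
by rewrite /diamond_col /=; case: (glued_col _) => [[]|].
Qed.

Lemma diamond_j_col e : diamond_col (diamond_je e) != Blue.
Proof.
have := glued_col_l (jmath_col D e).
by rewrite /diamond_col /=; case: (glued_col _) => [[]|].
Qed.

Definition diamond : bigraph K3 K1 :=
  @Bigraph K3 K1 diamond_graph diamond_col
    (Embedding diamond_iv_inj diamond_ie_inj diamond_ie_ends)
    (Embedding diamond_jv_inj diamond_je_inj diamond_je_ends)
    diamond_i_col diamond_j_col.
End Diamond.

(* Main.v *)
Require Import Defs.
From mathcomp Require Import all_boot.

(* Only the connectivity of the black-blue and black-red subgraphs matters.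
   A glued graph stays connected once its uncolored edges are removed, so
   iterated removal of the vertices of valence 1 never isolates a vertex and
   ends at the core: the largest set of vertices in which every unprotected
   vertex has valence at least 2. Place the three bi-trees in the unpruned
   triple gluing. A core is monotone, and pruning the gluing of two of the
   bi-trees first only removes vertices and edges outside the core of the whole.
   Hence both bracketings are the core of the triple gluing, colored by the
   associative mixing of colors. *)

Set Implicit Arguments.
Unset Strict Implicit.
Unset Printing Implicit Defensive.

(** * Cores of graphs with protected vertices *)

Section Core.
Variable T : graph.
Implicit Types (S : {set edge T}) (F W : {set vert T}).

Definition star S W v : {set edge T} :=
  [set e in S | (v \in ends e) && (ends e \subset W)].

Definition stable S F W :=
  [forall v in W, (v \in F) || (1 < #|star S W v|)].

Definition core S F := \bigcup_(W | stable S F W) W.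

Lemma star_mono S S' W W' v :
  S \subset S' -> W \subset W' -> star S W v \subset star S' W' v.
Proof.
move=> sS sW; apply/subsetP => e; rewrite !inE => /and3P[eS -> eW].
by rewrite (subsetP sS) // (subset_trans eW).
Qed.

Lemma stableP S F W :
  reflect {in W, forall v, v \notin F -> 1 < #|star S W v|} (stable S F W).
Proof.
apply: (iffP forall_inP) => st v vW; last by case: (boolP (v \in F)) => //= /st->.
by move=> nF; have := st v vW; rewrite (negPf nF).
Qed.

Lemma stable_core S F W : stable S F W -> W \subset core S F.
Proof. by move=> st; apply: bigcup_sup. Qed.

(** Enlarging a vertex set only enlarges the stars, so a union of stable sets is stable and the core
    is the largest one. *)
Lemma core_stable S F : stable S F (core S F).
Proof.
apply/stableP => v /bigcupP[W st vW] nF.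
by apply: leq_trans (stableP _ _ _ st v vW nF) (subset_leq_card (star_mono _ _ _)) => //;
  apply: stable_core.
Qed.

Lemma sub_core S F : F \subset core S F.
Proof. by apply: stable_core; apply/stableP => v ->. Qed.

Lemma core_gt1 S F v : v \in core S F -> v \notin F ->
  exists e e', [/\ e \in star S (core S F) v, e' \in star S (core S F) v & e != e'].
Proof. by move=> vC nF; apply/card_gt1P; apply: (stableP _ _ _ (core_stable S F)). Qed.

Lemma core_mono S S' F : S \subset S' -> core S F \subset core S' F.
Proof.
move=> sS; apply/stable_core/stableP => v vC nF.
apply: leq_trans (subset_leq_card (star_mono v sS (subxx _))).
exact: (stableP _ _ _ (core_stable S F)).
Qed.

Definition supp (c : edge T -> option color) : {set edge T} :=
  [set e | c e != None].

(* [a] and [b] color two parts of the graph, with vertices [V] and [B]; pruning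
   the first part, with [F1] protected, does not change the final core. *)
Lemma core_absorb (m : option color -> option color -> option color)
    (a a' b : edge T -> option color) (F1 F V B : {set vert T})
    (c := fun e => m (a e) (b e)) (c' := fun e => m (a' e) (b e)) :
  (forall x, m None x = x) -> (forall x, m x None = x) ->
  (forall e, a e != None -> ends e \subset V) ->
  (forall e, b e != None -> ends e \subset B) ->
  V :&: B \subset F1 -> F \subset F1 :|: B ->
  (forall e, a' e = if ends e \subset core (supp a) F1 then a e else None) ->
  core (supp c') F = core (supp c) F /\
  (forall e, ends e \subset core (supp c) F -> c' e = c e).
Proof.
move=> m0x mx0 aV bB VB FB a'E; set C := core (supp c) F; set C1 := core _ F1 in a'E *.
have F1C1 : F1 \subset C1 by apply: sub_core.
(* An erased edge has its ends in [V]. Were it also colored by [b], they would lie in [V :&: B],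
   hence in [C1], and it would not be erased. So [c'] is [c] without the erased edges. *)
have c'E e : c' e = if (a e != None) && ~~ (ends e \subset C1) then None else c e.
  rewrite /c' a'E; case: (boolP (ends e \subset C1)) => eC1; first by rewrite andbF.
  rewrite andbT m0x; case: (eqVneq (a e) None) => [a0|/aV eV] /=; first by rewrite /c a0 m0x.
  apply: contraNeq eC1 => /bB eB; apply: subset_trans F1C1; apply: subset_trans VB.
  by rewrite subsetI eV.
(* A vertex of [V] outside [F1] is outside [B], so every edge at it colored by [c] is colored by
   [a]. *)
have ca e v : v \in V -> v \notin F1 -> v \in ends e -> c e != None -> a e != None.
  rewrite /c => vV nF1 ve; apply: contraNneq => ->; rewrite m0x.
  apply: contraNT nF1 => /bB/subsetP eB; apply: (subsetP VB).
  by rewrite inE vV eB.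
have VF : V :&: F \subset F1.
  apply/subsetP => v /setIP[vV /(subsetP FB)/setUP[//|vB]].
  by apply: (subsetP VB); rewrite inE vV.
(* [F1 :|: (C :&: V)] is stable for [a]: its vertices outside [F1] keep all their edges inside [C],
   and by [ca] these belong to the first part. *)
have CV : C :&: V \subset C1.
  apply: subset_trans (stable_core (W := F1 :|: (C :&: V)) _); first exact: subsetUr.
  apply/stableP => v; rewrite !inE => /orP[->//|/andP[vC vV]] nF1.
  have nF : v \notin F by apply: contraNN nF1 => vF; rewrite (subsetP VF) // inE vV.
  apply: leq_trans (stableP _ _ _ (core_stable _ _) v vC nF) (subset_leq_card _).
  apply/subsetP => e; rewrite !inE => /and3P[ce ve eC].
  have ae := ca e v vV nF1 ve ce.
  rewrite ae ve /=; apply: subset_trans (subsetUr _ _).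
  by rewrite subsetI eC aV.
have cc' e : ends e \subset C -> c' e = c e.
  move=> eC; rewrite c'E; case: ifP => // /andP[ae /negP[]].
  by apply: subset_trans CV; rewrite subsetI eC aV.
(* One inclusion is monotonicity. For the other, [c'] and [c] agree on the edges inside [C], so [C]
   stays stable for [c']. *)
split=> //; apply/eqP; rewrite eqEsubset core_mono /=.
  apply/stable_core/stableP => v vC nF.
  apply: leq_trans (stableP _ _ _ (core_stable _ _) v vC nF) (subset_leq_card _).
  by apply/subsetP => e; rewrite !inE => /and3P[ce -> eC]; rewrite cc' // ce.
by apply/subsetP => e; rewrite !inE c'E; case: ifP.
Qed.

End Core.

(** Injectivity lets stable sets be carried both ways. A vertex outside the image is neither
    protected nor an end of a carried edge, so it is not in the core. *)
Lemma core_embedding (X T : graph) (h : embedding X T)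
    (S : {set edge X}) (F : {set vert X}) :
  core (emb_e h @: S) (emb_v h @: F) = emb_v h @: core S F.
Proof.
have vI := @emb_v_inj _ _ h; have eI := @emb_e_inj _ _ h.
apply/eqP; rewrite eqEsubset; apply/andP; split; last first.
  apply/stable_core/stableP => _ /imsetP[v vC ->]; rewrite mem_imset // => nF.
  have [e [e' []]] := core_gt1 vC nF; rewrite !inE => /and3P[eS ve eC] /and3P[eS' ve' eC'] ne.
  apply/card_gt1P; exists (emb_e h e), (emb_e h e'); rewrite !inE !emb_ends !imsetS //.
  by rewrite !mem_imset // eS ve eS' ve' inj_eq.
set C := core _ _.
have inX v : v \in C -> exists x, v = emb_v h x.
  move=> vC; case: (boolP (v \in emb_v h @: F)) => [/imsetP[x _ ->]|nF]; first by exists x.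
  have [e [_ [+ _ _]]] := core_gt1 vC nF; rewrite inE => /and3P[/imsetP[f _ ->]].
  by rewrite emb_ends => /imsetP[x _ ->]; exists x.
suff sC : emb_v h @^-1: C \subset core S F.
  apply/subsetP => v vC; have [x vE] := inX v vC; rewrite vE; apply: imset_f.
  by apply: (subsetP sC); rewrite inE -vE.
apply/stable_core/stableP => x; rewrite inE => xC nF.
have nF' : emb_v h x \notin emb_v h @: F by rewrite mem_imset.
have [e1 [e2 []]] := core_gt1 xC nF'; rewrite !inE.
case/and3P=> /imsetP[e eS ->{e1}] + + /and3P[/imsetP[e' eS' ->{e2}]].
rewrite !emb_ends !mem_imset // => xe /subsetP eC xe' /subsetP eC' ne.
apply/card_gt1P; exists e, e'; rewrite !inE eS eS' xe xe' -(inj_eq eI) ne.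
by split=> //=; apply/subsetP => y ye; rewrite inE; [apply: eC|apply: eC']; apply: imset_f.
Qed.

(** * Connectivity of pruned and of glued graphs *)

Section Connectivity.
Variable T : graph.
Implicit Types (S : {set edge T}) (W : {set vert T}).

Definition adj S W : rel (vert T) :=
  fun x y => [exists e in S, (ends e == [set x; y]) && (ends e \subset W)].

Definition conn S W := {in W &, forall x y, connect (adj S W) x y}.

Lemma adjP S W x y :
  reflect (exists e, [/\ e \in S, ends e = [set x; y] & ends e \subset W])
          (adj S W x y).
Proof.
apply: (iffP exists_inP) => [[e eS /andP[/eqP eE eW]]|[e [eS eE eW]]]; exists e => //.
by rewrite eW eE eqxx.
Qed.

Lemma adj_sym S W : symmetric (adj S W).
Proof. by move=> x y; apply/adjP/adjP => -[e [? ? ?]]; exists e; rewrite setUC. Qed.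

Lemma adj_connect_sym S W : connect_sym (adj S W).
Proof. exact/sym_connect_sym/adj_sym. Qed.

Lemma ends_neq (e : edge T) x y : ends e = [set x; y] -> x != y.
Proof.
by move=> eE; have := card_ends e; rewrite eE cards2; case: (x != y).
Qed.

Lemma conn_mono S S' W : S \subset S' -> conn S W -> conn S' W.
Proof.
move=> sS cS x y xW yW; apply: connect_sub (cS x y xW yW) => u v /adjP[e [eS eE eW]].
by apply/connect1/adjP; exists e; rewrite (subsetP sS).
Qed.

(* The interior vertices of a path without repetition have two distinct
   neighbors, so that they survive the pruning step. *)
Lemma prune_step_conn S' S F W :
  S' \subset S -> conn S' W -> conn S' (prune_step S F W).
Proof.
move=> sS cW x y xW' yW'; set W' := prune_step S F W.
have sW : {subset W' <= W} by move=> v; rewrite /W' inE => /andP[].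
have /connectP[p0 p0x yE] := cW x y (sW _ xW') (sW _ yW').
case/shortenP: p0x yE => p px up _ yE; rewrite {y}yE in yW' *.
suff: path (adj S' W') x p by move=> ?; apply/connectP; exists p.
have edge' u v : u \in W' -> v \in W' -> adj S' W u v -> adj S' W' u v.
  move=> uW vW /adjP[e [eS eE eW]]; apply/adjP; exists e; split=> //.
  by rewrite eE subUset !sub1set uW.
elim: p x xW' px up yW' => //= z p IH x xW' /andP[xz zp] /andP[xp up] yW'.
have zW' : z \in W'.
  case: p zp xp up yW' {IH} => //= w p /andP[zw _]; rewrite /W' !inE !negb_or.
  case/and3P=> _ xw _ _ _.
  have [[e [eS eE eW]] [e' [eS' eE' eW']]] := (adjP _ _ _ _ xz, adjP _ _ _ _ zw).
  have -> /= : z \in W by apply: (subsetP eW); rewrite eE !inE eqxx orbT.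
  apply/orP; right; rewrite neq_ltn; apply/orP; right; apply/card_gt1P.
  exists e, e'; rewrite !inE !(subsetP sS) // eW eW' eE eE' !inE !eqxx orbT.
  (* If [e = e'], then [x] would be [z] or [w]: the first is excluded since there are no loops, the
     second since the path has no repetition. *)
  split=> //; apply: contraTneq isT => ee; have : x \in ends e' by rewrite -ee eE !inE eqxx.
  by rewrite eE' !inE (negPf xw) (negPf (ends_neq eE)).
by rewrite edge' //= IH.
Qed.

Lemma prune_conn S' S F :
  S' \subset S -> conn S' setT -> conn S' (prune S F).
Proof. by move=> sS cT; rewrite /prune; elim: #|_| => //= n; apply: prune_step_conn. Qed.

(** As long as the iteration moves, each step loses a vertex. After [#|vert T|] steps it is
    stationary or has reached the empty set, which is fixed too. *)
Lemma prune_fixed S F : prune_step S F (prune S F) = prune S F.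
Proof.
have sub W : prune_step S F W \subset W by apply/subsetP => v; rewrite inE => /andP[].
pose it n := iter n (prune_step S F) setT; rewrite /prune.
have : prune_step S F (it #|vert T|) = it #|vert T| \/
    #|it #|vert T| | + #|vert T| <= #|vert T|.
  elim: {1 2 3 4}#|vert T| => [|n]; first by right; rewrite addn0 max_card.
  case=> [fix_n|le_n]; first by left; rewrite /= !fix_n.
  case: (eqVneq (it n.+1) (it n)) => [fix_n|neq]; [left|right].
    by rewrite -[it n.+1]/(prune_step S F (it n)) in fix_n *; rewrite !fix_n.
  rewrite addnS -addSn; apply: leq_trans le_n; rewrite leq_add2r.
  by apply: proper_card; rewrite properEneq neq /= sub.
case=> //; rewrite -[X in _ <= X]add0n leq_add2r leqn0 cards_eq0 => /eqP it0.
by apply/eqP; rewrite -/(it _) it0 -subset0 sub.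
Qed.

(** Pruning stops when no unprotected vertex has valence 1. The result is connected and has a
    protected vertex, so valence 0 is excluded as well and the result is stable. Conversely the core
    survives every step. *)
Lemma prune_core S F : F != set0 -> conn S setT -> prune S F = core S F.
Proof.
move=> /set0Pn[f fF] cS; have cP := prune_conn (F := F) (subxx S) cS.
apply/eqP; rewrite eqEsubset; apply/andP; split.
  apply/stable_core/stableP => v vP nF; have := vP.
  rewrite -{1}prune_fixed inE vP (negPf nF) /= neq_ltn => /orP[|//].
  rewrite ltnS leqn0 cards_eq0 => /eqP star0.
  have /connectP[[|w p] /=] := cP v f vP (subsetP (sub_prune _ _) _ fF).
    by move=> _ vf; rewrite -vf fF in nF.
  case/andP=> /adjP[e [eS eE eP]] _ _; have : e \in set0; last by rewrite inE.
  by rewrite -star0 !inE eS eP eE !inE eqxx.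
rewrite /prune; elim: #|_| => [|n IH] /=; first exact: subsetT.
apply/subsetP => v vC; rewrite inE (subsetP IH) //=; case: (boolP (v \in F)) => //= nF.
rewrite neq_ltn orbC; apply/orP; left.
apply: leq_trans (stableP _ _ _ (core_stable S F) v vC nF) _.
exact/subset_leq_card/star_mono.
Qed.

End Connectivity.

Lemma connect_homo (A B : finType) (r : rel A) (r' : rel B) (f : A -> B) :
  (forall x y, r x y -> connect r' (f x) (f y)) ->
  forall x y, connect r x y -> connect r' (f x) (f y).
Proof.
move=> rr' x _ /connectP[p + ->]; elim: p x => //= z p IH x /andP[xz /IH].
exact/connect_trans/rr'.
Qed.

(** An edge of [SB] missing from [S] has both ends in the image of [A], where [SA] provides a
    detour. The common vertex links the two images. *)
Lemma conn_amalgam (A B T : graph) (a : embedding A T) (b : embedding B T)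
    (SA : {set edge A}) (SB : {set edge B}) (S : {set edge T}) x0 y0 :
  emb_v a x0 = emb_v b y0 ->
  (forall v, (exists x, v = emb_v a x) \/ (exists y, v = emb_v b y)) ->
  (forall e, e \in SA -> emb_e a e \in S) ->
  (forall e, e \in SB -> emb_e b e \in S \/
     forall y, y \in ends e -> exists x, emb_v b y = emb_v a x) ->
  conn SA setT -> conn SB setT -> conn S setT.
Proof.
move=> xy0 cover SAS SBS cA cB.
have cTA x x' : connect (adj S setT) (emb_v a x) (emb_v a x').
  apply: connect_homo (cA x x' (in_setT _) (in_setT _)) => u v /adjP[e [eS eE _]].
  apply/connect1/adjP; exists (emb_e a e); rewrite SAS // emb_ends eE subsetT.
  by rewrite imsetU1 imset_set1.
have cTB y y' : connect (adj S setT) (emb_v b y) (emb_v b y').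
  apply: connect_homo (cB y y' (in_setT _) (in_setT _)) => u v /adjP[e [eS eE _]].
  case: (SBS e eS) => [eS'|inA].
    apply/connect1/adjP; exists (emb_e b e); rewrite eS' emb_ends eE subsetT.
    by rewrite imsetU1 imset_set1.
  have [|x ->] := inA u; first by rewrite eE !inE eqxx.
  by have [|x' ->] := inA v; first by rewrite eE !inE eqxx orbT.
have c0 v : connect (adj S setT) (emb_v a x0) v.
  by have [[x ->]|[y ->]] := cover v; last rewrite xy0.
by move=> u v _ _; apply: connect_trans (c0 v); rewrite adj_connect_sym.
Qed.

Lemma spanning_conn (G : graph) (S : {set edge G}) :
  connected (spanning_subgraph S) -> conn S setT.
Proof.
move=> cS x y _ _; pose V := vert (spanning_subgraph S).
apply: (connect_homo (f := val : V -> vert G)) (cS (Sub x (in_setT x)) (Sub y (in_setT y))).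
move=> u v /existsP[e /eqP eE]; apply/connect1/adjP; exists (val e).
rewrite subsetT; split=> //; first by case/andP: (valP e).
apply/setP => w; have /setP/(_ (Sub w (in_setT w))) := eE.
by rewrite !inE -!val_eqE !SubK.
Qed.

Lemma conn_subgraph (X : graph) (W : {set vert X}) (S S' : {set edge X})
    (Q : {set edge (subgraph W S)}) :
  S' \subset S -> (forall e : edge (subgraph W S), val e \in S' -> e \in Q) ->
  conn S' W -> connected (spanning_subgraph Q).
Proof.
move=> sS S'Q cW x y; pose V := vert (subgraph W S).
(* The default value in [insubd] is never taken: [f] is evaluated at relevant vertices in [W]
   only. *)
pose f v : vert (spanning_subgraph Q) := Sub (insubd (val x : V) v) (in_setT _).
have fK z : f (val (val z)) = z by apply: val_inj; rewrite /= valKd.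
have xyW (z : vert (spanning_subgraph Q)) : val (val z) \in W := valP (val z).
rewrite -[x]fK -[y]fK; apply: connect_homo (cW _ _ (xyW x) (xyW y)) => u v.
case/adjP=> e [eS' eE eW].
have eP : (e \in S) && (ends e \subset W) by rewrite (subsetP sS).
pose e1 : edge (subgraph W S) := Sub e eP.
have e1P : (e1 \in Q) && (ends e1 \subset [set: V]) by rewrite subsetT S'Q.
apply/connect1/existsP; exists (Sub e1 e1P); apply/eqP/setP => w.
have [uW vW] : u \in W /\ v \in W.
  by split; apply: (subsetP eW); rewrite eE !inE eqxx ?orbT.
have wf z : z \in W -> (val (val w) == z) = (w == f z).
  by move=> zW; rewrite -(inj_eq val_inj) -(inj_eq val_inj) /= insubdK.
by rewrite !inE /= eE !inE !wf.
Qed.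

(** * Colored graphs placed inside an ambient graph *)

Section Placement.
Variables (K1 K2 : graph) (X : bigraph K2 K1) (T : graph) (h : embedding X T).

(** The coloring of [X] pushed forward along [h], so that placed graphs can be compared and mixed
    edge by edge in [T]. *)
Definition pcol (e : edge T) : option color :=
  omap (fun x => col x) [pick x | emb_e h x == e].

Lemma pcol_emb x : pcol (emb_e h x) = Some (col x).
Proof.
rewrite /pcol; case: pickP => [y /eqP/emb_e_inj->//|/(_ x)]; by rewrite eqxx.
Qed.

Variant pcol_spec e : option color -> Prop :=
  | PcolSome x of e = emb_e h x : pcol_spec e (Some (col x))
  | PcolNone of (forall x, e <> emb_e h x) : pcol_spec e None.

Lemma pcolP e : pcol_spec e (pcol e).
Proof.
rewrite /pcol; case: pickP => [x /eqP<-|nx] /=; first by constructor.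
by constructor => x ex; have := nx x; rewrite ex eqxx.
Qed.

Lemma pcol_out e : (forall x, e <> emb_e h x) -> pcol e = None.
Proof. by case: pcolP => // x ex /(_ x). Qed.

End Placement.

Definition emb_comp (A B C : graph) (g : embedding B C) (f : embedding A B) :
  embedding A C.
Proof.
apply: (@Embedding A C (emb_v g \o emb_v f) (emb_e g \o emb_e f)).
- exact/inj_comp/emb_v_inj/emb_v_inj.
- exact/inj_comp/emb_e_inj/emb_e_inj.
- by move=> e; rewrite /= !emb_ends -imset_comp.
Defined.

Definition emb_eq (A B : graph) (f g : embedding A B) :=
  (forall x, emb_v f x = emb_v g x) /\ (forall e, emb_e f e = emb_e g e).

Lemma emb_eq_refl (A B : graph) (f : embedding A B) : emb_eq f f.
Proof. by []. Qed.

(** [None] is a two-sided unit, standing for absent and for removed edges alike; [mix] acts only on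
    edges present on both sides. *)
Definition ocmix (c d : option color) : option color :=
  match c, d with
  | None, _ => d
  | _, None => c
  | Some x, Some y => mix x y
  end.

Definition marks (A B T : graph) (p : embedding A T) (q : embedding B T) :=
  [set v | (v \in codom (emb_v p)) || (v \in codom (emb_v q))].

(** [h] identifies [X] with the core of the part of [T] colored by [c], the images of [p] and [q]
    being protected. This determines [X] up to equivalence. *)
Definition placed (I J T : graph) (X : bigraph I J) (h : embedding X T)
    (p : embedding I T) (q : embedding J T) (c : edge T -> option color) :=
  let C := core (supp c) (marks p q) in
  [/\ emb_eq (emb_comp h (imath X)) p, emb_eq (emb_comp h (jmath X)) q,
      forall v, (v \in codom (emb_v h)) = (v \in C) &
      forall e, pcol h e = if ends e \subset C then c e else None].

(** The isomorphism is [h] followed by the inverse of [k] on their common image. Equal pushed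
    colorings force equal edge images as well as equal colors. *)
Lemma bi_equiv_of_embeddings (I J T : graph) (X Y : bigraph I J) (h : embedding X T)
    (k : embedding Y T) :
  emb_eq (emb_comp h (imath X)) (emb_comp k (imath Y)) ->
  emb_eq (emb_comp h (jmath X)) (emb_comp k (jmath Y)) ->
  codom (emb_v h) =i codom (emb_v k) ->
  pcol h =1 pcol k ->
  bi_equiv X Y.
Proof.
move=> [iv ie] [jv je] hk_v hk_c.
have /fin_all_exists[fv fvE] x : exists y, emb_v k y = emb_v h x.
  have : emb_v h x \in codom (emb_v k) by rewrite -hk_v codom_f.
  by case/codomP=> y ->; exists y.
have /fin_all_exists[gv gvE] x : exists y, emb_v h y = emb_v k x.
  have : emb_v k x \in codom (emb_v h) by rewrite hk_v codom_f.
  by case/codomP=> y ->; exists y.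
have /fin_all_exists[fe feE] x : exists y, emb_e k y = emb_e h x /\ col y = col x.
  have := hk_c (emb_e h x); rewrite pcol_emb; case: pcolP => // y -> [->].
  by exists y.
have /fin_all_exists[ge geE] x : exists y, emb_e h y = emb_e k x.
  by have := hk_c (emb_e k x); rewrite pcol_emb; case: pcolP => // y ->; exists y.
exists fv, fe; split; split.
- by exists gv => x; [apply: (@emb_v_inj _ _ h)|apply: (@emb_v_inj _ _ k)];
    rewrite ?gvE ?fvE ?gvE.
- by exists ge => x; [apply: (@emb_e_inj _ _ h)|apply: (@emb_e_inj _ _ k)];
    rewrite ?geE ?(feE _).1 ?geE.
- move=> e; apply: (imset_inj (@emb_v_inj _ _ k)).
  rewrite -emb_ends (feE e).1 emb_ends -imset_comp.
  by apply: eq_imset => x; rewrite /= fvE.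
- by move=> e; have [] := feE e.
- by move=> x; apply: (@emb_v_inj _ _ k); rewrite fvE; apply: iv.
- by move=> x; apply: (@emb_e_inj _ _ k); rewrite (feE _).1; apply: ie.
- by move=> x; apply: (@emb_v_inj _ _ k); rewrite fvE; apply: jv.
- by move=> x; apply: (@emb_e_inj _ _ k); rewrite (feE _).1; apply: je.
Qed.

(** * Gluings as pushouts *)

Lemma glueP (A B C : finType) (f : A -> B) (g : A -> C) (x : gluing f g) :
  injective f -> (exists b, x = glue_l f g b) \/ (exists c, x = glue_r f g c).
Proof.
move=> fI; case: x => [a|[[b bP]|[c cP]]].
- by left; exists (f a); rewrite glue_l_im.
- left; exists b; rewrite /glue_l; case: (decP _) => h; first by case/negP: (bP).
  by congr (inr (inl _)); apply: val_inj.
- right; exists c; rewrite /glue_r; case: (decP _) => h; first by case/negP: (cP).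
  by congr (inr (inr _)); apply: val_inj.
Qed.

Lemma glue_meet (A B C : finType) (f : A -> B) (g : A -> C) b c :
  glue_l f g b = glue_r f g c -> exists a, b = f a /\ c = g a.
Proof.
rewrite /glue_l /glue_r; case: (decP _) => hb; case: (decP _) => hc //= [eq_a].
by exists (iinv hb); rewrite f_iinv eq_a f_iinv.
Qed.

Section GlueMap.
Variables (A B C P : finType) (f : A -> B) (g : A -> C) (l : B -> P) (r : C -> P).
Hypotheses (fI : injective f) (lI : injective l) (rI : injective r).
Hypothesis comm : forall a, l (f a) = r (g a).
Hypothesis meet : forall b c, l b = r c -> exists a, b = f a /\ c = g a.

Definition glue_map (x : gluing f g) : P :=
  match x with
  | inl a => l (f a)
  | inr (inl b) => l (val b)
  | inr (inr c) => r (val c)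
  end.

Lemma glue_map_l b : glue_map (glue_l f g b) = l b.
Proof. by rewrite /glue_l; case: (decP _) => h //=; rewrite f_iinv. Qed.

Lemma glue_map_r c : glue_map (glue_r f g c) = r c.
Proof. by rewrite /glue_r; case: (decP _) => h //=; rewrite comm f_iinv. Qed.

(** Elements from opposite sides can have equal images only along [A], by [meet], and there the
    gluing already identifies them. *)
Lemma glue_map_inj : injective glue_map.
Proof.
have gI : injective g by move=> a a' /(congr1 r); rewrite -!comm => /lI/fI.
move=> x y; have [[b ->]|[c ->]] := glueP x fI; have [[b' ->]|[c' ->]] := glueP y fI.
- by rewrite !glue_map_l => /lI->.
- by rewrite glue_map_l glue_map_r => /meet[a [-> ->]]; rewrite glue_l_im // glue_r_im.
- by rewrite glue_map_l glue_map_r => /esym/meet[a [-> ->]]; rewrite glue_l_im // glue_r_im.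
- by rewrite !glue_map_r => /rI->.
Qed.
End GlueMap.

(* [a] and [b] meet exactly along [K]. *)
Definition amalgam (K A B T : graph) (i : embedding K A) (j : embedding K B)
    (a : embedding A T) (b : embedding B T) :=
  [/\ emb_eq (emb_comp a i) (emb_comp b j),
      forall x y, emb_v a x = emb_v b y -> exists k, x = emb_v i k /\ y = emb_v j k &
      forall x y, emb_e a x = emb_e b y -> exists k, x = emb_e i k /\ y = emb_e j k].

(** A property inherited by products, by [diamond_conn], so that a product can itself be glued and
    pruned to a core. *)
Definition biconn (I J : graph) (X : bigraph I J) :=
  connected (black_blue X) /\ connected (black_red X).

(** * The product: coloring, connectivity and core *)

Section Product.
Variables (K1 K2 K3 : graph) (D : bigraph K2 K1) (G : bigraph K3 K2).

Definition emb_l : embedding D (glued D G) :=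
  @Embedding D (glued D G) (glued_l (D := D) G) (glued_le (D := D) G) (@glue_l_inj _ _ _ _ _)
    (@glue_l_inj _ _ _ _ _) (glued_le_ends (D := D) G).

Definition emb_r : embedding G (glued D G) :=
  @Embedding G (glued D G) (glued_r D (G := G)) (glued_re D (G := G)) (@glue_r_inj _ _ _ _ _)
    (@glue_r_inj _ _ _ _ _) (glued_re_ends D (G := G)).

Lemma glued_amalgam : amalgam (imath D) (jmath G) emb_l emb_r.
Proof.
split; [split=> k | move=> x y | move=> x y]; try exact: glue_meet.
- by rewrite /= /glued_l /glued_r glue_l_im ?glue_r_im //; apply: emb_v_inj.
- by rewrite /= /glued_le /glued_re glue_l_im ?glue_r_im //; apply: emb_e_inj.
Qed.

Lemma gluedP v :
  (exists x, v = emb_v emb_l x) \/ (exists y, v = emb_v emb_r y).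
Proof. exact/glueP/emb_v_inj. Qed.

Lemma gluedPe e :
  (exists x, e = emb_e emb_l x) \/ (exists y, e = emb_e emb_r y).
Proof. exact/glueP/emb_e_inj. Qed.

(** Replaces the case analysis on glued edges by a mixture of two pushed colorings, a form suited to
    repeated gluing. *)
Lemma glued_colE e : glued_col e = ocmix (pcol emb_l e) (pcol emb_r e).
Proof.
have [[iv ie] _ meet_e] := glued_amalgam.
case: e => [k|[[d dP]|[c cP]]] /=.
- have El : inl k = emb_e emb_l (emb_e (imath D) k).
    by rewrite /= /glued_le glue_l_im //; apply: emb_e_inj.
  have Er : inl k = emb_e emb_r (emb_e (jmath G) k) by rewrite El; apply: ie.
  by rewrite {1}El Er !pcol_emb.
- have El : inr (inl (exist _ d dP)) = emb_e emb_l d.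
    rewrite /= /glued_le /glue_l; case: (decP _) => h; first by case/negP: (dP).
    by congr (inr (inl _)); apply: val_inj.
  rewrite El pcol_emb pcol_out // => y /meet_e[k [dE _]].
  by case/negP: (dP); rewrite dE codom_f.
- have Er : inr (inr (exist _ c cP)) = emb_e emb_r c.
    rewrite /= /glued_re /glue_r; case: (decP _) => h; first by case/negP: (cP).
    by congr (inr (inr _)); apply: val_inj.
  rewrite Er pcol_emb pcol_out // => x /esym/meet_e[k [_ cE]].
  by case/negP: (cP); rewrite cE codom_f.
Qed.

(** The black-blue part of the gluing for [c = Red], the black-red part for [c = Blue]. *)
Definition glued_avoiding (c : color) : {set edge (glued D G)} :=
  [set e | (glued_col e != None) && (glued_col e != Some c)].

Lemma glued_avoiding_sub c : glued_avoiding c \subset kept_edges D G.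
Proof. by apply/subsetP => e; rewrite !inE => /andP[]. Qed.

Hypothesis K2_gt0 : 0 < #|vert K2|.
Hypotheses (Dconn : biconn D) (Gconn : biconn G).

Lemma glued_conn c : c != Black -> conn (glued_avoiding c) setT.
Proof.
have [[iv ie] meet_v meet_e] := glued_amalgam.
have [k _] := card_gt0P K2_gt0.
have ivk m : emb_v emb_l (emb_v (imath D) m) = emb_v emb_r (emb_v (jmath G) m) := iv m.
case: c => // _.
(* Black-red edges of [D] stay black or red. One of [G] can be removed or turn blue only on [K2],
   and then its ends belong to [D]. *)
- apply: (conn_amalgam (ivk k) gluedP) (spanning_conn Dconn.2) (spanning_conn Gconn.2) => e.
    by rewrite !inE; apply: glued_col_l.
  rewrite !inE => eB; case: (pcolP emb_l (emb_e emb_r e)) (glued_colE (emb_e emb_r e)).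
    move=> d eE _; right => y; have [m [_ ->]] := meet_e _ _ (esym eE).
    by rewrite emb_ends => /imsetP[x _ ->]; exists (emb_v (imath D) x); rewrite ivk.
  by move=> _ /= ->; left; rewrite pcol_emb.
(* The black-blue part, with [D] and [G] exchanged. *)
- apply: (conn_amalgam (esym (ivk k)) _) (spanning_conn Gconn.1) (spanning_conn Dconn.1).
  + by move=> v; have [?|?] := gluedP v; [right|left].
  + by move=> e; rewrite !inE; apply: glued_col_r.
  move=> e; rewrite !inE => eB.
  case: (pcolP emb_r (emb_e emb_l e)) (glued_colE (emb_e emb_l e)).
    move=> d eE _; right => y; have [m [-> _]] := meet_e _ _ eE.
    by rewrite emb_ends => /imsetP[x _ ->]; exists (emb_v (jmath G) x); rewrite ivk.
  by move=> _ /=; rewrite pcol_emb => ->; left.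
Qed.

(** Pruning counts kept edges of all colors, yet [prune_conn] applies to each of the two color
    classes separately. *)
Lemma diamond_conn : biconn (diamond D G).
Proof.
have main c (Q : {set edge (diamond_graph D G)}) : c != Black ->
    (forall e : edge (diamond D G), col e != c -> e \in Q) ->
    connected (spanning_subgraph Q).
  move=> cB colQ; apply: (conn_subgraph (glued_avoiding_sub c)); last first.
    exact: prune_conn (glued_avoiding_sub c) (glued_conn cB).
  move=> e; rewrite inE => /andP[e0 ec]; apply: colQ; move: e0 ec.
  by rewrite /= /diamond_col; case: (glued_col _).
by split; [apply: (main Red) | apply: (main Blue)] => // e; rewrite inE.
Qed.

Hypothesis K1_gt0 : 0 < #|vert K1|.

Lemma kept_core : kept_verts D G = core (kept_edges D G) (fixed_verts D G).
Proof.
apply: prune_core; last exact: conn_mono (glued_avoiding_sub Red) (glued_conn _).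
have [k _] := card_gt0P K1_gt0; apply/set0Pn.
exists (glued_l G (emb_v (jmath D) k)); rewrite inE; apply/orP; right.
exact: imset_f.
Qed.

End Product.

Lemma pcol_comp (I J : graph) (X : bigraph I J) (Y T : graph)
    (f : embedding Y T) (a : embedding X Y) e :
  pcol (emb_comp f a) (emb_e f e) = pcol a e.
Proof.
case: (pcolP a e) => [x ->|ne]; first exact: (pcol_emb (emb_comp f a)).
by rewrite pcol_out // => x /emb_e_inj; apply: ne.
Qed.

Lemma pcol_eq (I J : graph) (X : bigraph I J) (T : graph) (a b : embedding X T) :
  emb_eq a b -> pcol a =1 pcol b.
Proof.
move=> [_ ab] e; case: (pcolP b e) => [x ->|ne]; first by rewrite -ab pcol_emb.
by rewrite pcol_out // => x; rewrite ab.
Qed.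

Lemma sub_ends_val (X : graph) (W : {set vert X}) (S : {set edge X})
    (e : edge (subgraph W S)) : ends (val e) = val @: (ends e : {set vert (subgraph W S)}).
Proof.
apply/setP => v; apply/idP/imsetP => [ve|[u + ->]]; last by rewrite inE.
have /andP[_ /subsetP eW] := valP e.
by exists (Sub v (eW v ve)); rewrite ?inE SubK.
Qed.

Definition emb_sub (X : graph) (W : {set vert X}) (S : {set edge X}) :
    embedding (subgraph W S) X :=
  @Embedding (subgraph W S) X val val val_inj val_inj (@sub_ends_val X W S).

Lemma imset_subset (A B : finType) (f : A -> B) (U V : {set A}) :
  injective f -> (f @: U \subset f @: V) = (U \subset V).
Proof.
move=> fI; apply/idP/idP => [/subsetP sUV|]; last exact: imsetS.
by apply/subsetP => x xU; rewrite -(mem_imset _ _ fI) sUV // imset_f.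
Qed.

(** * Placement of a product in an ambient graph *)

Section DiamondPlacement.
Variables (K1 K2 K3 : graph) (D : bigraph K2 K1) (G : bigraph K3 K2).
Variables (T : graph) (d : embedding D T) (g : embedding G T).
Variables (p : embedding K3 T) (q : embedding K1 T).
Hypothesis dg : amalgam (imath D) (jmath G) d g.
Hypotheses (gp : emb_eq (emb_comp g (imath G)) p).
Hypotheses (dq : emb_eq (emb_comp d (jmath D)) q).
Hypotheses (K1_gt0 : 0 < #|vert K1|) (K2_gt0 : 0 < #|vert K2|).
Hypotheses (Dconn : biconn D) (Gconn : biconn G).

Definition glued_mapv : vert (glued D G) -> vert T :=
  glue_map (f := emb_v (imath D)) (g := emb_v (jmath G)) (emb_v d) (emb_v g).
Definition glued_mape : edge (glued D G) -> edge T :=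
  glue_map (f := emb_e (imath D)) (g := emb_e (jmath G)) (emb_e d) (emb_e g).

Lemma glued_mapv_l x : glued_mapv (emb_v (emb_l D G) x) = emb_v d x.
Proof. exact: glue_map_l. Qed.

Lemma glued_mape_l x : glued_mape (emb_e (emb_l D G) x) = emb_e d x.
Proof. exact: glue_map_l. Qed.

Lemma glued_mapv_r x : glued_mapv (emb_v (emb_r D G) x) = emb_v g x.
Proof. by have [[iv _] _ _] := dg; apply: glue_map_r. Qed.

Lemma glued_mape_r x : glued_mape (emb_e (emb_r D G) x) = emb_e g x.
Proof. by have [[_ ie] _ _] := dg; apply: glue_map_r. Qed.

Lemma glued_mapv_inj : injective glued_mapv.
Proof. by have [[iv _] ? _] := dg; apply: glue_map_inj => //; apply: emb_v_inj. Qed.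

Lemma glued_mape_inj : injective glued_mape.
Proof. by have [[_ ie] _ ?] := dg; apply: glue_map_inj => //; apply: emb_e_inj. Qed.

Lemma glued_map_ends e : ends (glued_mape e) = glued_mapv @: ends e.
Proof.
have [[x ->]|[x ->]] := gluedPe e.
  by rewrite glued_mape_l !emb_ends -imset_comp; apply: eq_imset => y; rewrite /= glued_mapv_l.
by rewrite glued_mape_r !emb_ends -imset_comp; apply: eq_imset => y; rewrite /= glued_mapv_r.
Qed.

Definition glued_map : embedding (glued D G) T :=
  Embedding glued_mapv_inj glued_mape_inj glued_map_ends.

Let c e := ocmix (pcol d e) (pcol g e).

Lemma glued_map_col e : c (glued_mape e) = glued_col e.
Proof.
rewrite glued_colE /c -(pcol_comp glued_map (emb_l D G)) -(pcol_comp glued_map (emb_r D G)).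
by congr ocmix; apply: pcol_eq; split=> x;
  rewrite /= ?(glued_mapv_l, glued_mape_l, glued_mapv_r, glued_mape_r).
Qed.

Lemma supp_glued : supp c = glued_mape @: kept_edges D G.
Proof.
apply/setP => e; apply/idP/imsetP => [|[e' + ->]]; last by rewrite !inE glued_map_col.
rewrite inE => ce; suff [e' eE] : exists e', e = glued_mape e'.
  by exists e' => //; rewrite inE -glued_map_col -eE.
move: ce; rewrite /c; case: (pcolP d e) => [x -> _|_].
  by exists (emb_e (emb_l D G) x); rewrite glued_mape_l.
case: (pcolP g e) => // x -> _.
by exists (emb_e (emb_r D G) x); rewrite glued_mape_r.
Qed.

Lemma marks_glued : marks p q = glued_mapv @: fixed_verts D G.
Proof.
have [[pv _] [qv _]] := (gp, dq); apply/setP => v; rewrite inE imsetU inE; congr (_ || _).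
  apply/codomP/imsetP => [[x ->]|[_ /imsetP[x _ ->] ->]].
    by exists (emb_v (emb_r D G) (emb_v (imath G) x)); [apply: imset_f | rewrite glued_mapv_r -pv].
  by exists x; rewrite glued_mapv_r -pv.
apply/codomP/imsetP => [[x ->]|[_ /imsetP[x _ ->] ->]].
  by exists (emb_v (emb_l D G) (emb_v (jmath D) x)); [apply: imset_f | rewrite glued_mapv_l -qv].
by exists x; rewrite glued_mapv_l -qv.
Qed.

Definition diamond_emb : embedding (diamond D G) T :=
  emb_comp glued_map (emb_sub (kept_verts D G) (kept_edges D G)).

Lemma diamond_emb_cover_v x :
  (exists a, emb_v diamond_emb x = emb_v d a) \/ (exists b, emb_v diamond_emb x = emb_v g b).
Proof.
rewrite /=; have [[y ->]|[y ->]] := gluedP (val x).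
  by left; exists y; rewrite glued_mapv_l.
by right; exists y; rewrite glued_mapv_r.
Qed.

Lemma diamond_emb_cover_e x :
  (exists a, emb_e diamond_emb x = emb_e d a) \/ (exists b, emb_e diamond_emb x = emb_e g b).
Proof.
rewrite /=; have [[y ->]|[y ->]] := gluedPe (val x).
  by left; exists y; rewrite glued_mape_l.
by right; exists y; rewrite glued_mape_r.
Qed.

(** [glued_map] carries kept edges onto [supp c] and fixed vertices onto the marks, so
    [core_embedding] carries the kept vertices onto the core in [T]. *)
Lemma diamond_placed : placed diamond_emb p q c.
Proof.
have CE : core (supp c) (marks p q) = glued_mapv @: kept_verts D G.
  by rewrite supp_glued marks_glued (core_embedding glued_map) kept_core.
have [[pv pe] [qv qe]] := (gp, dq); rewrite /placed CE; split.
- by split=> x; rewrite -(pv, pe); [apply: glued_mapv_r|apply: glued_mape_r].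
- by split=> x; rewrite -(qv, qe); [apply: glued_mapv_l|apply: glued_mape_l].
- move=> v; apply/codomP/imsetP => [[x ->]|[x xW ->]]; first by exists (val x) => //; apply: valP.
  by exists (Sub x xW).
move=> e; case: (pcolP diamond_emb e) => [x ->|ne].
  have /andP[xS xW] := valP x.
  rewrite emb_ends [emb_v diamond_emb @: _](imset_comp glued_mapv val) -sub_ends_val.
  rewrite imset_subset ?xW; last exact: glued_mapv_inj.
  rewrite [emb_e diamond_emb x]/(glued_mape (val x)) glued_map_col.
  by move: xS; rewrite inE /= /diamond_col; case: (glued_col _).
(* A colored edge inside the core comes from a kept edge with kept ends, that is, from an edge of
   the product. *)
case: ifP => // eC; case cE : (c e) => [k|//].
have : e \in supp c by rewrite inE cE.
rewrite supp_glued => /imsetP[e' eS eE].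
have eP : (e' \in kept_edges D G) && (ends e' \subset kept_verts D G).
  by rewrite eS; move: eC; rewrite eE glued_map_ends imset_subset //; apply: glued_mapv_inj.
by case: (ne (Sub e' eP)).
Qed.

End DiamondPlacement.

Lemma eq_supp (T : graph) (c c' : edge T -> option color) : c =1 c' -> supp c = supp c'.
Proof. by move=> cc'; apply/setP => e; rewrite !inE cc'. Qed.

(** An edge in both images comes from [K2], whose embeddings avoid red in [D] and blue in [G]. *)
Lemma amalgam_pcol (K1 K2 K3 T : graph) (D : bigraph K2 K1) (G : bigraph K3 K2)
    (d : embedding D T) (g : embedding G T) e x y :
  amalgam (imath D) (jmath G) d g ->
  pcol d e = Some x -> pcol g e = Some y -> x != Red /\ y != Blue.
Proof.
move=> [_ _ meet_e]; case: pcolP => // u eu [<-]; case: pcolP => // v ev [<-].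
by have [k [-> ->]] := meet_e u v (etrans (esym eu) ev); split; rewrite ?imath_col ?jmath_col.
Qed.

Lemma pcol_ends (I J T : graph) (X : bigraph I J) (h : embedding X T) e :
  pcol h e != None -> ends e \subset [set v in codom (emb_v h)].
Proof.
case: pcolP => // x -> _; rewrite emb_ends; apply/subsetP => _ /imsetP[v _ ->].
by rewrite inE codom_f.
Qed.

Lemma ocmix_neq0 a b : ocmix a b != None -> a != None \/ b != None.
Proof. by case: a; [left | right]. Qed.

(** * Both bracketings as one core *)

Section Associativity.
Variables (J1 J2 J3 J4 : graph).
Variables (L : bigraph J2 J1) (D : bigraph J3 J2) (G : bigraph J4 J3) (T : graph).
Variables (l : embedding L T) (d : embedding D T) (g : embedding G T).
Hypotheses (ld : amalgam (imath L) (jmath D) l d) (dg : amalgam (imath D) (jmath G) d g).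
Hypothesis meet_v : forall x y, emb_v l x = emb_v g y -> exists z, emb_v l x = emb_v d z.
Hypothesis meet_e : forall x y, emb_e l x = emb_e g y -> exists z, emb_e l x = emb_e d z.
Hypotheses (J1_gt0 : 0 < #|vert J1|) (J2_gt0 : 0 < #|vert J2|) (J3_gt0 : 0 < #|vert J3|).
Hypotheses (Lconn : biconn L) (Dconn : biconn D) (Gconn : biconn G).

Let p := emb_comp g (imath G).
Let q := emb_comp l (jmath L).
Let c e := ocmix (ocmix (pcol l e) (pcol d e)) (pcol g e).

(** An edge in all three graphs is black in [D], not red in [L] and not blue in [G]. An edge outside
    [D] is outside [L] or [G], by [meet_e]. Elsewhere [None] acts as a unit. *)
Lemma ocmixA e : c e = ocmix (pcol l e) (ocmix (pcol d e) (pcol g e)).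
Proof.
have ldE x y := amalgam_pcol (e := e) (x := x) (y := y) ld.
have dgE x y := amalgam_pcol (e := e) (x := x) (y := y) dg.
have lgE : pcol d e = None -> pcol l e = None \/ pcol g e = None.
  case: (pcolP d e) => // nd _; case: (pcolP l e) => [x ex|]; last by left.
  case: (pcolP g e) => [y ey|]; last by right.
  by have [z] := meet_e (etrans (esym ex) ey); rewrite -ex => /nd.
rewrite /c; case: (pcol l e) ldE lgE => [x|//]; case: (pcol d e) dgE => [y|].
  case: (pcol g e) => [z|] dgE ldE _; last by rewrite /=; case: (mix x y).
  have [[xR yB] [yR zB]] := (ldE _ _ erefl erefl, dgE _ _ erefl erefl).
  by case: x xR {ldE} => // _; case: y yB yR {dgE} => // _ _; case: z zB.
by move=> _ _ /(_ erefl)[|->].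
Qed.

(** [diamond L D] is placed first, with [J3] and [J1] protected. It still contains [J3] and meets
    [G] exactly there, so its product with [G] can be placed; [core_absorb] then replaces the pruned
    coloring by the full one. *)
Lemma left_placed :
  exists h : embedding (diamond (diamond L D) G) T, placed h p q c.
Proof.
pose r := emb_comp d (imath D); pose h := diamond_emb ld.
have [[hr_v hr_e] hq h_v h_c] :=
  diamond_placed (p := r) (q := q) ld (emb_eq_refl _) (emb_eq_refl _) J1_gt0 J2_gt0 Lconn Dconn.
have hg : amalgam (imath (diamond L D)) (jmath G) h g.
  have [[iv ie] dgv dge] := dg; split.
  - by split=> x; [apply: etrans (hr_v x) (iv x)|apply: etrans (hr_e x) (ie x)].
  - move=> x y hE.
    (* A vertex of the product lying in [G] comes from [D], directly or by [meet_v], hence from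
       [J3]. *)
    have [z dz] : exists z, emb_v d z = emb_v g y.
      have [[a ha]|[b hb]] := diamond_emb_cover_v ld x; last by exists b; rewrite -hb.
      by have [|z az] := meet_v (x := a) (y := y); [rewrite -ha|exists z; rewrite -az -ha].
    have [k [zE yE]] := dgv _ _ dz; exists k; split=> //; apply: (@emb_v_inj _ _ h).
    by rewrite hE -dz zE; apply/esym/hr_v.
  - move=> x y hE.
    have [z dz] : exists z, emb_e d z = emb_e g y.
      have [[a ha]|[b hb]] := diamond_emb_cover_e ld x; last by exists b; rewrite -hb.
      by have [|z az] := meet_e (x := a) (y := y); [rewrite -ha|exists z; rewrite -az -ha].
    have [k [zE yE]] := dge _ _ dz; exists k; split=> //; apply: (@emb_e_inj _ _ h).
    by rewrite hE -dz zE; apply/esym/hr_e.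
exists (diamond_emb hg).
have [kp kq k_v k_c] := diamond_placed (p := p) (q := q) hg (emb_eq_refl _) hq
  J1_gt0 J3_gt0 (diamond_conn J2_gt0 Lconn Dconn) Gconn.
(* The part pruned first is the mixture of [L] and [D]; the vertices it shares with [G] come from
   [J3], which was protected. *)
have [||||||CE c'E] := core_absorb (m := ocmix) (b := pcol g) (F := marks p q)
  (V := [set v | (v \in codom (emb_v l)) || (v \in codom (emb_v d))])
  (B := [set v in codom (emb_v g)]) _ _ _ _ _ _ h_c.
- by [].
- by case.
- move=> e /ocmix_neq0[] /pcol_ends eV; apply: subset_trans eV _;
    by apply/subsetP => v; rewrite !inE => ->; rewrite ?orbT.
- by move=> e; apply: pcol_ends.
- have [[iv _] dgv _] := dg.
  apply/subsetP => v; rewrite !inE => /andP[ldv /codomP[y vy]].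
  have [z dz] : exists z, emb_v d z = emb_v g y.
    case/orP: ldv => /codomP[x vx]; last by exists x; rewrite -vx.
    by have [|z az] := meet_v (x := x) (y := y); [rewrite -vx|exists z; rewrite -az -vx].
  have [k [zE _]] := dgv _ _ dz; apply/orP; left; apply/codomP; exists k.
  by rewrite vy -dz zE.
- apply/subsetP => v; rewrite !inE => /orP[/codomP[x ->]|->]; last by rewrite orbT.
  by apply/orP; right; apply: codom_f.
split=> //; first by move=> v; rewrite k_v CE.
by move=> e; rewrite k_c CE; case: ifP => // /c'E.
Qed.

Lemma right_placed :
  exists h : embedding (diamond L (diamond D G)) T, placed h p q c.
Proof.
pose s := emb_comp d (jmath D); pose h := diamond_emb dg.
have [hp [hs_v hs_e] h_v h_c] :=
  diamond_placed (p := p) (q := s) dg (emb_eq_refl _) (emb_eq_refl _) J2_gt0 J3_gt0 Dconn Gconn.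
have lh : amalgam (imath L) (jmath (diamond D G)) l h.
  have [[iv ie] ldv lde] := ld; split.
  - by split=> x; [apply: etrans (iv x) (esym (hs_v x))|apply: etrans (ie x) (esym (hs_e x))].
  - move=> x y hE.
    have [z dz] : exists z, emb_v l x = emb_v d z.
      have [[b hb]|[a ha]] := diamond_emb_cover_v dg y; first by exists b; rewrite -hb.
      by apply: (meet_v (y := a)); rewrite -ha.
    have [k [xE zE]] := ldv _ _ dz; exists k; split=> //; apply: (@emb_v_inj _ _ h).
    by rewrite -hE dz zE; apply/esym/hs_v.
  - move=> x y hE.
    have [z dz] : exists z, emb_e l x = emb_e d z.
      have [[b hb]|[a ha]] := diamond_emb_cover_e dg y; first by exists b; rewrite -hb.
      by apply: (meet_e (y := a)); rewrite -ha.
    have [k [xE zE]] := lde _ _ dz; exists k; split=> //; apply: (@emb_e_inj _ _ h).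
    by rewrite -hE dz zE; apply/esym/hs_e.
exists (diamond_emb lh).
have [kp kq k_v k_c] := diamond_placed (p := p) (q := q) lh hp (emb_eq_refl _)
  J1_gt0 J2_gt0 Lconn (diamond_conn J3_gt0 Dconn Gconn).
(* The part pruned first is now the right factor, so [ocmix] takes its arguments exchanged; the
   vertices shared with [L] come from [J2]. *)
have [||||||CE c'E] := core_absorb (m := fun x y => ocmix y x) (b := pcol l) (F := marks p q)
  (V := [set v | (v \in codom (emb_v d)) || (v \in codom (emb_v g))])
  (B := [set v in codom (emb_v l)]) _ _ _ _ _ _ h_c.
- by case.
- by [].
- move=> e /ocmix_neq0[] /pcol_ends eV; apply: subset_trans eV _;
    by apply/subsetP => v; rewrite !inE => ->; rewrite ?orbT.
- by move=> e; apply: pcol_ends.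
- have [[iv _] ldv _] := ld.
  apply/subsetP => v; rewrite !inE => /andP[dgv /codomP[x vx]].
  have [z dz] : exists z, emb_v l x = emb_v d z.
    case/orP: dgv => /codomP[y vy]; first by exists y; rewrite -vx.
    by apply: (meet_v (y := y)); rewrite -vx.
  have [k [_ zE]] := ldv _ _ dz; apply/orP; right; apply/codomP; exists k.
  by rewrite vx dz zE.
- apply/subsetP => v; rewrite !inE => /orP[->//|/codomP[x ->]].
  by apply/orP; right; apply: codom_f.
rewrite -(eq_supp ocmixA) in CE c'E.
split=> //; first by move=> v; rewrite k_v CE.
by move=> e; rewrite k_c CE; case: ifP => // /c'E ->; rewrite ocmixA.
Qed.

Lemma diamond_assoc_amalgam :
  bi_equiv (diamond (diamond L D) G) (diamond L (diamond D G)).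
Proof.
have [h [[hpv hpe] [hqv hqe] h_v h_c]] := left_placed.
have [k [[kpv kpe] [kqv kqe] k_v k_c]] := right_placed.
apply: (bi_equiv_of_embeddings (h := h) (k := k)).
- by split=> x; rewrite (hpv, hpe) (kpv, kpe).
- by split=> x; rewrite (hqv, hqe) (kqv, kqe).
- by move=> v; rewrite h_v k_v.
- by move=> e; rewrite h_c k_c.
Qed.

End Associativity.

(** * The triple gluing *)

Lemma glued_i_col (K1 K2 K3 : graph) (D : bigraph K2 K1) (G : bigraph K3 K2) e :
  odflt Black (glued_col (emb_e (emb_comp (emb_r D G) (imath G)) e)) != Red.
Proof. by have := glued_col_r D (imath_col G e); rewrite /=; case: (glued_col _) => [[]|]. Qed.

Lemma glued_j_col (K1 K2 K3 : graph) (D : bigraph K2 K1) (G : bigraph K3 K2) e :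
  odflt Black (glued_col (emb_e (emb_comp (emb_l D G) (jmath D)) e)) != Blue.
Proof. by have := glued_col_l G (jmath_col D e); rewrite /=; case: (glued_col _) => [[]|]. Qed.

(** Removed edges stay, under the placeholder color [Black], so that the next gluing contains all
    three bi-trees whole. *)
Definition glued_bigraph (K1 K2 K3 : graph) (D : bigraph K2 K1) (G : bigraph K3 K2) :
    bigraph K3 K1 :=
  @Bigraph K3 K1 (glued D G) (fun e => odflt Black (glued_col e))
    (emb_comp (emb_r D G) (imath G)) (emb_comp (emb_l D G) (jmath D))
    (@glued_i_col _ _ _ D G) (@glued_j_col _ _ _ D G).

Lemma is_bitree_biconn (I J : graph) (X : bigraph I J) : is_bitree X -> biconn X.
Proof. by case=> -[_ ? _] [_ ? _] _. Qed.

Theorem lemma4p3 (J1 J2 J3 J4 : graph)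
  (treeJ1 : is_tree J1) (treeJ2 : is_tree J2)
  (treeJ3 : is_tree J3) (treeJ4 : is_tree J4)
  (Lambda : bigraph J2 J1) (Delta : bigraph J3 J2) (Gamma : bigraph J4 J3)
  (bitreeL : is_bitree Lambda) (bitreeD : is_bitree Delta)
  (bitreeG : is_bitree Gamma) :
  bi_equiv (diamond (diamond Lambda Delta) Gamma)
           (diamond Lambda (diamond Delta Gamma)).
Proof.
pose P := glued_bigraph Lambda Delta.
pose l := emb_comp (emb_l P Gamma) (emb_l Lambda Delta).
pose d := emb_comp (emb_l P Gamma) (emb_r Lambda Delta).
have [[iv ie] mv me] := glued_amalgam Lambda Delta.
have [[iv' ie'] mv' me'] := glued_amalgam P Gamma.
case: treeJ1 treeJ2 treeJ3 => ? _ _ [? _ _] [? _ _].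
apply: (@diamond_assoc_amalgam _ _ _ _ _ _ _ _ l d (emb_r P Gamma)) => //;
  try exact: is_bitree_biconn.
(* [Lambda] and [Delta] already meet along [J2] in [P], which is embedded in the triple gluing. *)
- split; [split=> x | move=> x y | move=> x y].
  + exact: congr1 (iv x).
  + exact: congr1 (ie x).
  + by move/(@emb_v_inj _ _ (emb_l P Gamma))/mv.
  + by move/(@emb_e_inj _ _ (emb_l P Gamma))/me.
(* [P] meets [Gamma] along [J3], which is embedded in [P] through [Delta]. *)
- split; [by split=> x; [apply: iv'|apply: ie'] | move=> x y | move=> x y].
  + by case/mv'=> k [xE yE]; exists k; split=> //; apply: (@emb_v_inj _ _ (emb_r Lambda Delta)).
  + by case/me'=> k [xE yE]; exists k; split=> //; apply: (@emb_e_inj _ _ (emb_r Lambda Delta)).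
(* What [Lambda] shares with [Gamma] comes from [J3], hence lies in [Delta]. *)
- by move=> x y /mv'[k [xE _]]; exists (emb_v (imath Delta) k); apply: congr1 xE.
- by move=> x y /me'[k [xE _]]; exists (emb_e (imath Delta) k); apply: congr1 xE.
Qed.
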